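(* (In $\mathrm{ZFC}$, for the coherent Suslin tree $\mathbb{S}$.) There is $c : \mathbb{S}^{[2]} \to 2$ such that (1) there is no $X \in [\mathbb{S}]^{\omega_1}$ such that $X^{[2]} \subset K_0$; (2) there are no $s \in \mathbb{S}$ and $B \subset \mathrm{pred}_{\mathbb{S}}(s)$ such that $\mathrm{otp}(B) = \omega+2$ and $B^{[2]} \subset K_1$.
   Context: $\mathbb{S}$ is a fixed coherent strongly homogeneous Suslin tree, meaning: (1) $\mathbb{S}$ is a Suslin tree (an $\omega_1$-tree with no uncountable chains or antichains) and is a subtree of $\omega^{<\omega_1}$ (ordered by extension); (2) for each $s \in \mathbb{S}$ there are infinitely many $n \in \omega$ with $s^\frown\langle n\rangle \in \mathbb{S}$, and $\{t \in \mathbb{S} : t \geq s\}$ is uncountable; (3) for all $s,t \in \mathbb{S}$, $\{\xi \in \mathrm{dom}(s)\cap\mathrm{dom}(t) : s(\xi) \neq t(\xi)\}$ is finite; (4) for each $\xi<\omega_1$ and $s,t \in \mathbb{S}_\xi$ (the $\xi$-th level) there is an automorphism $\phi$ of $\mathbb{S}$ with $\phi(s)=t$ and $\phi(u) = \phi(u\restriction\xi) \cup u\restriction[\xi,\alpha)$ for all $\alpha\geq\xi$ and $u \in \mathbb{S}_\alpha$. For $A \subset \mathbb{S}$, $A^{[2]} = \{\{a,b\} : a,b\in A,\ a<b\}$ (pairs of comparable elements). $K_i = \{\{s,t\} \in \mathbb{S}^{[2]} : c(\{s,t\}) = i\}$ for $i\in 2=\{0,1\}$. $\mathrm{pred}_{\mathbb{S}}(s)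 = \{u \in \mathbb{S} : u \leq s\}$. $\mathrm{otp}$ denotes order type, and $[X]^{\omega_1}$ is the set of subsets of $X$ of cardinality $\omega_1$. *)

(* Defs.v *)
From mathcomp Require Import all_boot all_order.
From mathcomp Require Import boolp classical_sets functions cardinality.
From Stdlib Require Import Relation_Operators.

Set Implicit Arguments.
Unset Strict Implicit.
Unset Printing Implicit Defensive.

Local Open Scope classical_set_scope.
Local Open Scope order_scope.
Local Open Scope card_scope.

Definition order_iso (T U : Type) (A : set T) (R : T -> T -> Prop)
    (B : set U) (Q : U -> U -> Prop) (f : T -> U) : Prop :=
  set_bij A B f /\ forall x y, A x -> A y -> (R x y <-> Q (f x) (f y)).

Definition below (d : Order.disp_t) (W : orderType d) (a : W) : set W :=
  [set x | x < a].

(* The ordinal omega_1 is represented by an arbitrary copy of it: an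
   uncountable well-order all of whose proper initial segments are countable.
   An element a stands for the ordinal [below a], so that W is at the same
   time omega_1 and the type of the ordinals below omega_1. *)
Definition is_omega1 (d : Order.disp_t) (W : orderType d) : Prop :=
  [/\ well_founded (fun x y : W => x < y),
      ~ countable [set: W] &
      forall a : W, countable (below a)].

(* omega + 2, as the ordered sum of nat and 'I_2. *)
Definition lt_omega_plus2 : nat + 'I_2 -> nat + 'I_2 -> Prop :=
  le_AsB nat 'I_2 (fun m n => (m < n)%N) (fun i j => (i < j)%N).

Section SequenceTrees.
Context (d : Order.disp_t) (W : orderType d).

(* Partial functions from omega_1 to omega; [seqs] carves out omega^{<omega_1},
   the functions whose domain is an ordinal below omega_1. *)
Definition pfun := W -> option nat.

Implicit Types (s t u : pfun) (S A B : set pfun) (a : W).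

Definition dom s : set W := [set x | s x <> None].

Definition seqs : set pfun := [set s | exists a, dom s = below a].

Definition restr s (D : set W) : pfun := patch (fun=> None) D s.

(* The union of two partial functions with disjoint domains. *)
Definition glue s t : pfun := patch t (dom s) s.

(* s followed by n: the new value is put at the ordinal x equal to dom s. *)
Definition snoc s (n : nat) : pfun :=
  fun x => if `[< dom s = below x >] then Some n else s x.

Definition ext_le s t : Prop := forall x n, s x = Some n -> t x = Some n.

Definition ext_lt s t : Prop := ext_le s t /\ s <> t.

Definition ext_comparable s t : Prop := ext_le s t \/ ext_le t s.

Definition chain A : Prop := forall s t, A s -> A t -> ext_comparable s t.

Definition antichain A : Prop :=
  forall s t, A s -> A t -> s <> t -> ~ ext_comparable s t.

Definition subtree S : Prop :=
  S `<=` seqs /\ forall s a, S s -> S (restr s (below a)).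

(* In a subtree the a-th level consists of the elements with domain a. *)
Definition level S a : set pfun := [set s | S s /\ dom s = below a].

(* Height omega_1 amounts to all the levels being nonempty. *)
Definition omega1_tree S : Prop :=
  subtree S /\ forall a, level S a !=set0 /\ countable (level S a).

Definition suslin_tree S : Prop :=
  [/\ omega1_tree S,
      ~ exists A, [/\ A `<=` S, chain A & ~ countable A] &
      ~ exists A, [/\ A `<=` S, antichain A & ~ countable A]].

Definition automorphism S (phi : pfun -> pfun) : Prop :=
  order_iso S ext_le S ext_le phi.

Record coherent_suslin_tree S : Prop := CoherentSuslinTree {
  cst_suslin : suslin_tree S;
  cst_infinite_branching :
    forall s, S s -> infinite_set [set n | S (snoc s n)];
  cst_uncountable_cones :
    forall s, S s -> ~ countable [set t | S t /\ ext_le s t];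
  cst_coherent :
    forall s t, S s -> S t ->
      finite_set [set x | [/\ dom s x, dom t x & s x <> t x]];
  cst_homogeneous :
    forall xi s t, level S xi s -> level S xi t ->
      exists phi, [/\ automorphism S phi, phi s = t &
        forall a u, xi <= a -> level S a u ->
          phi u = glue (phi (restr u (below xi))) (restr u [set x | xi <= x < a])]
}.

Definition pairs A : set (set pfun) :=
  [set p | exists s t, [/\ A s, A t, ext_lt s t & p = [set s; t]]].

(* A colouring of [pairs S] is a function on all sets of partial functions,
   its values outside [pairs S] being irrelevant; the colours 0 and 1 are
   false and true. *)
Definition colour_class S (c : set pfun -> bool) (i : bool) :
  set (set pfun) := [set p | pairs S p /\ c p = i].

Definition preds S s : set pfun := [set u | S u /\ ext_le u s].

Definition otp_omega_plus2 B : Prop :=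
  exists f, order_iso [set: nat + 'I_2] lt_omega_plus2 B ext_lt f.

End SequenceTrees.

(* Main.v *)
(* Attach to every level a real so that distinct levels get distinct reals, and
   let F s be the real of the level of s.  Since s has infinitely many immediate
   successors, they can be labelled by finite binary words v so that every word
   occurs; for s < t, let v be the label of the successor of s below t, and give
   {s, t} colour 1 when v is an initial segment of F t but not of F s.
   If s_0 < s_1 < ... < t < u has colour 1, the word v_i of s_i is the same below
   all the later points.  It is an initial segment of both F t and F u, so there
   are finitely many words, whereas v_i <> v_j for i < j because v_i is an
   initial segment of F s_j and v_j is not.
   If X is uncountable, some word v and some s are such that, above s, both the
   elements t of X with v an initial segment of F t and the others are dense:
   otherwise, for all v at once, the nodes of some level decide whether v is an
   initial segment, so X has countably many elements.  Then choose u in X above s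
   such that v is not an initial segment of F u, and t in X above the successor
   of u labelled v such that v is an initial segment of F t. *)
Require Import Defs.
From mathcomp Require Import all_boot all_order.
From mathcomp Require Import boolp classical_sets functions cardinality.
From Stdlib Require Import Relation_Operators.

Set Implicit Arguments.
Unset Strict Implicit.
Unset Printing Implicit Defensive.

Local Open Scope classical_set_scope.
Local Open Scope card_scope.

Import Order.TTheory.

Lemma countable_setU (T : Type) (A B : set T) :
  countable A -> countable B -> countable (A `|` B).
Proof.
by move=> cA cB; rewrite -bigcup2E; apply: bigcup_countable => // -[|[|i]].
Qed.

(** * Initial segments of reals *)

Definition starts_with (f : nat -> bool) (v : seq bool) : Prop :=
  mkseq f (size v) = v.

(** One inclusion suffices, because [f] has an initial segment of every length. *)
Lemma starts_with_inj (f g : nat -> bool) :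
  (forall v, starts_with f v -> starts_with g v) -> f = g.
Proof.
move=> fg; apply/funext => n.
have := fg (mkseq f n.+1); rewrite /starts_with size_mkseq => /(_ erefl).
move=> /(congr1 (nth false ^~ n)).
by rewrite !nth_mkseq.
Qed.

(** A common initial segment ends before the first difference of [f] and [g], and its length
    determines it; so only finitely many words are available. *)
Lemma starts_with_common (f g : nat -> bool) (v : nat -> seq bool) :
  f <> g -> (forall i, starts_with f (v i)) -> (forall i, starts_with g (v i)) ->
  exists i j, (i < j)%N /\ v i = v j.
Proof.
move=> fg fv gv.
have [N fgN] : exists N, f N <> g N.
  by apply/existsNP => h; apply: fg; apply/funext.
have sizeN i : (size (v i) < N.+1)%N.
  rewrite ltnS leqNgt; apply/negP => lt; apply: fgN.
  have := etrans (fv i) (esym (gv i)) => /(congr1 (nth false ^~ N)).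
  by rewrite !nth_mkseq.
pose h (i : 'I_N.+2) : 'I_N.+1 := Ordinal (sizeN i).
have /injectivePn [i [j ij hij]] : ~~ injectiveb h.
  apply/negP => /injectiveP /leq_card.
  by rewrite !card_ord ltnn.
have vij : v i = v j.
  by move: hij => /(congr1 val) /= sij; rewrite -(fv i) -(fv j) sij.
case: (ltngtP i j) => [lt|lt|/val_inj eij].
- by exists i, j.
- by exists j, i.
- by rewrite eij eqxx in ij.
Qed.

(** * The ordinal omega_1 *)

Section Omega1.
Context (d : Order.disp_t) (W : orderType d) (HW : is_omega1 W).
Implicit Types (a b x y : W) (s t u : pfun W).

Lemma omega1_ind (P : W -> Prop) :
  (forall x, (forall y, (y < x)%O -> P y) -> P x) -> forall x, P x.
Proof. by case: HW => wf _ _ step; apply: (well_founded_ind wf). Qed.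

Lemma omega1_least (P : set W) x :
  P x -> exists m, P m /\ forall y, (y < m)%O -> ~ P y.
Proof.
move: x; apply: (@omega1_ind (fun x => P x -> _)) => x IH Px.
case: (pselect (exists2 y, (y < x)%O & P y)) => [[y yx Py]|no].
  exact: IH yx Py.
by exists x; split=> // y yx Py; apply: no; exists y.
Qed.

(** Otherwise the countably many closed initial segments given by [C] would cover [W]. *)
Lemma omega1_bounded (C : set W) :
  countable C -> exists a, forall x, C x -> (x < a)%O.
Proof.
move=> cC; apply: contrapT => unb; case: HW => _ unc cbelow; apply: unc.
have -> : [set: W] = \bigcup_(x in C) (below x `|` [set x]).
  apply/seteqP; split => // a _.
  apply: contrapT => na; apply: unb; exists a => x Cx.
  rewrite ltNge; apply/negP; rewrite le_eqVlt => /orP[/eqP ax|ax]; apply: na.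
    by exists x => //; right.
  by exists x => //; left.
apply: bigcup_countable => // x _; apply: countable_setU.
  exact: cbelow.
exact: countable1.
Qed.

Lemma below_inj : injective (@below d W).
Proof.
move=> a b eab; have ab x : (x < a)%O = (x < b)%O.
  by have [f g] : below a x <-> below b x; [rewrite eab | apply/idP/idP].
by apply/eqP; rewrite eq_le !leNgt ab ltxx -ab ltxx.
Qed.

(* A level is coded by the isomorphic copy on natural numbers of its
   well-order; well-orders being rigid, the code determines the level. *)
Lemma level_reals : exists F : pfun W -> nat -> bool,
  forall s t, seqs s -> seqs t -> F s = F t -> dom s = dom t.
Proof.
have /choice[e einj] s : exists e : W -> nat,
    seqs s -> forall x y, dom s x -> dom s y -> e x = e y -> x = y.
  case: (pselect (seqs s)) => [[a sa]|ns]; last by exists (fun=> 0%N).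
  have /countable_injP[e ie] : countable (dom s) by case: HW => _ _; rewrite sa.
  by exists e => _ x y sx sy; apply: ie; rewrite inE.
(* The pairs with [x = y] record the values of [e s] on [dom s], the others its order. *)
pose code s n := exists x y,
  [/\ dom s x, dom s y, (x <= y)%O & n = pickle (e s x, e s y)].
have codeP s x y : seqs s -> dom s x -> dom s y ->
    code s (pickle (e s x, e s y)) -> (x <= y)%O.
  move=> ss sx sy [x' [y' [sx' sy' le /(pcan_inj pickleK)[ex ey]]]].
  by rewrite (einj s ss _ _ sx sx' ex) (einj s ss _ _ sy sy' ey).
exists (fun s n => `[< code s n >]) => s t ss st eqF.
have codeE n : code s n <-> code t n.
  by apply: asbool_eq_equiv; have := congr1 (fun g => g n) eqF.
have match_dom s' t' x : (forall n, code s' n -> code t' n) ->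
    dom s' x -> exists y, dom t' y /\ e s' x = e t' y.
  move=> sub sx.
  have /sub[y [_ [ty _ _ /(pcan_inj pickleK)[ey _]]]] :
    code s' (pickle (e s' x, e s' x)) by exists x, x.
  by exists y.
have match_lt s' t' x y x' y' : seqs s' -> seqs t' ->
    (forall n, code s' n <-> code t' n) ->
    dom s' x -> dom s' x' -> dom t' y -> dom t' y' ->
    e s' x = e t' y -> e s' x' = e t' y' -> (x' < x)%O -> (y' < y)%O.
  move=> ss' st' eqc sx sx' ty ty' exy exy'.
  rewrite !ltNge; apply: contra => le.
  by apply: (codeP s') => //; apply/eqc; rewrite exy exy'; exists y, y'.
have dom_lt s' x x' : seqs s' -> dom s' x -> (x' < x)%O -> dom s' x'.
  by case=> c ->; rewrite /below /= => xc /lt_trans; apply.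
(* By induction on [x], points with the same number have the same predecessors, hence are equal. *)
have main x : forall y, dom s x -> dom t y -> e s x = e t y -> x = y.
  elim/omega1_ind: x => x IH y sx ty exy.
  apply: below_inj; apply/seteqP; split => [x' x'x|y' y'y].
    have sx' := dom_lt _ _ _ ss sx x'x.
    have [y' [ty' exy']] : exists y, dom t y /\ e s x' = e t y.
      by apply: match_dom => // n /codeE.
    have := match_lt s t x y x' y' ss st codeE sx sx' ty ty' exy exy' x'x.
    by rewrite /below /= (IH x' x'x y').
  have ty' := dom_lt _ _ _ st ty y'y.
  have [x' [sx' exy']] : exists x, dom s x /\ e t y' = e s x.
    by apply: match_dom => // n /codeE.
  have x'x := match_lt t s y x y' x' st ss (fun n => iff_sym (codeE n))
    ty ty' sx sx' (esym exy) exy' y'y.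
  by rewrite /below /= -(IH x' x'x y').
apply/seteqP; split => [x sx|y ty].
  have [y [ty exy]] : exists y, dom t y /\ e s x = e t y.
    by apply: match_dom => // n /codeE.
  by rewrite (main x y).
have [x [sx exy]] : exists x, dom s x /\ e t y = e s x.
  by apply: match_dom => // n /codeE.
by rewrite -(main x y).
Qed.

(** * Partial functions ordered by extension *)

Lemma ext_le_refl s : ext_le s s.
Proof. by []. Qed.

Lemma ext_le_trans t s u : ext_le s t -> ext_le t u -> ext_le s u.
Proof. by move=> st tu x n /st /tu. Qed.

Lemma ext_le_dom s t : ext_le s t -> dom s `<=` dom t.
Proof.
by move=> st x; rewrite /dom /=; case E: (s x) => [n|] // _; rewrite (st _ _ E).
Qed.

(** This is what makes the order a tree: functions below [u] agree wherever both are defined. *)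
Lemma ext_le_comparable s t u :
  ext_le s u -> ext_le t u -> dom s `<=` dom t -> ext_le s t.
Proof.
move=> su tu sub x n sx.
have : dom t x by apply: sub; rewrite /dom /= sx.
rewrite /dom /=; case E: (t x) => [m|] // _.
by have := su _ _ sx; rewrite (tu _ _ E) => -[->].
Qed.

Lemma ext_le_eq s t : ext_le s t -> dom s = dom t -> s = t.
Proof.
move=> st eqd; apply/funext => x.
case E: (s x) => [n|]; first by rewrite (st _ _ E).
apply: contrapT => /nesym tx; have : dom s x by rewrite eqd.
by rewrite /dom /= E.
Qed.

Lemma ext_le_anti s t : ext_le s t -> ext_le t s -> s = t.
Proof.
move=> st ts; apply: ext_le_eq => //.
by apply/seteqP; split; apply: ext_le_dom.
Qed.

Lemma restr_ext_le s (D : set W) : ext_le (restr s D) s.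
Proof. by move=> x n; rewrite /restr /patch; case: ifP. Qed.

Lemma dom_restr s (D : set W) : dom (restr s D) = dom s `&` D.
Proof.
apply/seteqP; split => x; rewrite /dom /restr /patch /=.
  by case: ifP => // /set_mem.
by move=> [sx Dx]; rewrite mem_set.
Qed.

Lemma snoc_ext_le s n : ext_le s (snoc s n).
Proof.
move=> x m sx; rewrite /snoc asboolF // => eqd.
have : dom s x by rewrite /dom /= sx.
by rewrite eqd /below /= ltxx.
Qed.

Lemma snocE s n x : dom s = below x -> snoc s n x = Some n.
Proof. by move=> sx; rewrite /snoc asboolT. Qed.

Lemma dom_below_le s t x y :
  dom s = below x -> dom t = below y -> (x <= y)%O -> dom s `<=` dom t.
Proof. by move=> -> -> xy z /= zx; apply: lt_le_trans xy. Qed.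

(** * Dense open subsets of a Suslin tree *)

Section Suslin.
Context (S : set (pfun W)) (HS : suslin_tree S).

Lemma suslin_seqs s : S s -> seqs s.
Proof. by case: HS => -[[sub _] _] _ _; apply: sub. Qed.

Lemma suslin_restr s a : S s -> S (restr s (below a)).
Proof. by case: HS => -[[_ cl] _] _ _ /cl. Qed.

Lemma suslin_countable_level a : countable (level S a).
Proof. by case: HS => -[_ lev] _ _; case: (lev a). Qed.

Definition dense_open (E : set (pfun W)) : Prop :=
  (forall s, S s -> exists2 t, (S `&` E) t & ext_le s t) /\
  (forall s t, S s -> S t -> ext_le s t -> E s -> E t).

(** The minimal elements of [E] form an antichain, so countably many levels contain them all. A node
    beyond these levels has an extension in [E], hence lies above a minimal element. *)
Lemma dense_open_level (E : set (pfun W)) :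
  dense_open E -> exists a, forall b s, (a <= b)%O -> level S b s -> E s.
Proof.
move=> [dense up].
pose A := [set m | [/\ S m, E m & forall t, S t -> E t -> ext_le t m -> t = m]].
have cA : countable A.
  apply: contrapT => ncA; case: HS => _ _; apply; exists A; split=> //.
    by move=> m [].
  move=> s t [Ss Es ms] [St Et mt] st [le|le]; apply: st.
    exact: mt.
  by apply/esym/ms.
have minE t : S t -> E t -> exists2 m, A m & ext_le m t.
  move=> St Et; have [a ta] := suslin_seqs St.
  have at_a : restr t (below a) = t.
    apply: ext_le_eq; first exact: restr_ext_le.
    by rewrite dom_restr ta setIid.
  (* The shortest restriction of [t] in [E] is minimal, since every node below it is again a
     restriction of [t]. *)
  have [|x [Ex minx]] := @omega1_least (fun x => E (restr t (below x))) a.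
    by rewrite at_a.
  exists (restr t (below x)); last exact: restr_ext_le.
  split=> //; first exact: suslin_restr.
  move=> u Su Eu ux; have [y uy] := suslin_seqs Su.
  have ut : ext_le u t by apply: ext_le_trans ux (@restr_ext_le _ _).
  have uE : u = restr t (below y).
    apply: ext_le_eq.
      apply: (ext_le_comparable ut (@restr_ext_le _ _)).
      rewrite dom_restr uy => z zy; split=> //.
      by apply: (ext_le_dom ut); rewrite uy.
    rewrite dom_restr uy; apply/esym/setIidr; rewrite -uy.
    exact: ext_le_dom.
  case: (ltP y x) => [yx|xy]; first by case: (minx y yx); rewrite -uE.
  apply: ext_le_anti => //.
  apply: (ext_le_comparable (@restr_ext_le _ _) ut).
  by rewrite dom_restr uy => z [_ /= zx]; apply: lt_le_trans xy.
have /choice[lev levP] s : exists a, S s -> dom s = below a.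
  case: (pselect (S s)) => [/suslin_seqs[a sa]|nS]; first by exists a.
  (* Outside [S] the value of [lev] is arbitrary. *)
  case: HW => _ unc _; have [w _] : [set: W] !=set0.
    by apply/set0P/eqP => W0; apply: unc; rewrite W0.
  by exists w.
have [|a aP] := @omega1_bounded (lev @` A).
  exact: (sub_countable (card_image_le _ _)).
exists a => b s ab [Ss sb].
have [t [St Et] st] := dense s Ss.
have [m Am mt] := minE t St Et.
have [Sm Em _] := Am.
apply: up Em => //; apply: (ext_le_comparable mt st).
apply: (dom_below_le (levP _ Sm) sb).
by apply/ltW/(lt_le_trans _ ab)/aP; exists m.
Qed.

(** This is the omega-distributivity of a Suslin tree, expressed by a single level. *)
Lemma dense_open_bigcap (I : countType) (E : I -> set (pfun W)) :
  (forall i, dense_open (E i)) ->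
  exists a, forall i s, level S a s -> E i s.
Proof.
move=> /(_ _)/dense_open_level-/choice[a aP].
have [|b bP] := @omega1_bounded (range a).
  exact: (sub_countable (card_image_le _ _) (countableP _)).
by exists b => i s; apply: aP; apply/ltW/bP; exists i.
Qed.

Lemma uncountable_splitting (F : pfun W -> nat -> bool) (X : set (pfun W)) :
  (forall s t, seqs s -> seqs t -> F s = F t -> dom s = dom t) ->
  X `<=` S -> ~ countable X ->
  exists v s, S s /\ forall t, S t -> ext_le s t ->
    (exists2 u, X u & ext_le t u /\ starts_with (F u) v) /\
    (exists2 u, X u & ext_le t u /\ ~ starts_with (F u) v).
Proof.
move=> Finj XS ncX; apply: contrapT => no; apply: ncX.
(* The nodes that decide, for all elements of [X] above them, whether [v] is an initial segment. *)
pose E v := [set t | (forall u, X u -> ext_le t u -> ~ starts_with (F u) v) \/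
                     (forall u, X u -> ext_le t u -> starts_with (F u) v)].
have [v|a aP] := @dense_open_bigcap (seq bool) E.
  split=> [s Ss|s t _ _ st [] h]; last first.
  - by right=> u Xu tu; apply: h => //; apply: ext_le_trans tu.
  - by left=> u Xu tu; apply: h => //; apply: ext_le_trans tu.
  apply: contrapT => nE; apply: no; exists v, s; split=> // t St st.
  split; apply: contrapT => h; apply: nE; exists t => //; split=> //.
    by left=> u Xu tu sw; apply: h; exists u.
  by right=> u Xu tu; apply: contrapT => sw; apply: h; exists u.
have sub : X `<=` (\bigcup_(x in below a) level S x) `|`
    \bigcup_(s in level S a) [set t | X t /\ ext_le s t].
  move=> t Xt; have St := XS _ Xt; have [x tx] := suslin_seqs St.
  case: (ltP x a) => [xa|ax]; [left|right]; first by exists x.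
  exists (restr t (below a)); last by split=> //; apply: restr_ext_le.
  split; first exact: suslin_restr.
  by rewrite dom_restr tx; apply/setIidr => z /= za; apply: lt_le_trans ax.
apply: sub_countable (subset_card_le sub) _; apply: countable_setU.
  apply: bigcup_countable => [|x _]; last exact: suslin_countable_level.
  by case: HW.
apply: bigcup_countable => [|s sa]; first exact: suslin_countable_level.
(* Elements of [X] above the same [s] agree on every word, so they have the same real and lie on the
   level of [t]. *)
have [->//|/set0P[t [Xt st]]] := eqVneq [set t | X t /\ ext_le s t] set0.
have [x tx] := suslin_seqs (XS _ Xt).
apply: sub_countable (suslin_countable_level x); apply: subset_card_le.
move=> u [Xu su]; split; first exact: XS.
rewrite -tx; apply: Finj; [exact/suslin_seqs/XS..|].
by apply: starts_with_inj => v uv; case: (aP v s sa) => h; [case: (h u)|apply: h].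
Qed.

End Suslin.
End Omega1.

(** * The colouring and its two properties *)

Lemma set2_ext_lt (d : Order.disp_t) (W : orderType d) (s t s' t' : pfun W) :
  ext_lt s t -> ext_lt s' t' -> [set s; t] = [set s'; t'] -> s = s' /\ t = t'.
Proof.
move=> [st nst] [st' nst'] eqp.
have [] : [set s'; t'] s by rewrite -eqp; left.
  move=> ss'; split=> //.
  have [] : [set s'; t'] t by rewrite -eqp; right.
    by move=> ts'; case: nst; rewrite ss' ts'.
  by [].
move=> sE; have [] : [set s'; t'] t by rewrite -eqp; right.
  by move=> tE; case: nst; apply: ext_le_anti => //; rewrite tE sE.
by move=> tE; case: nst; rewrite sE tE.
Qed.

Theorem theorem25 (d : Order.disp_t) (W : orderType d) (HW : is_omega1 W)
    (S : set (pfun W)) (HS : coherent_suslin_tree S) :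
  exists c : set (pfun W) -> bool,
    (~ exists X : set (pfun W),
         [/\ X `<=` S, X #= [set: W] & pairs X `<=` colour_class S c false]) /\
    (~ exists (s : pfun W) (B : set (pfun W)),
         [/\ S s, B `<=` preds S s, otp_omega_plus2 B &
             pairs B `<=` colour_class S c true]).
Proof.
have HT := cst_suslin HS.
have [F Finj] := level_reals HW.
have /choice[h hP] s : exists h : nat -> seq bool,
    S s -> forall v, exists2 n, S (snoc s n) & h n = v.
  case: (pselect (S s)) => [Ss|nS]; last by exists (fun=> [::]).
  have /infiniteP/pcard_surjP[g gs] := cst_infinite_branching HS Ss.
  (* Surject the successors of [s] onto the numbers and decode; numbers that code no word give the
     empty one. *)
  exists (fun n => odflt [::] (unpickle (g n))) => _ v.
  have [n Sn gn] := gs (pickle v) I.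
  by exists n => //; rewrite gn pickleK.
(* For [s] below [t], the value of [t] at the ordinal [dom s] selects the successor of [s] below
   [t], whose label is [v]. *)
pose guess s t v := exists x n, [/\ dom s = below x, t x = Some n & h s n = v].
have guess_mono s t u v : ext_le t u -> guess s t v -> guess s u v.
  by move=> tu [x [n [sx tn hv]]]; exists x, n; split=> //; apply: tu.
have guess_inj s t v w : guess s t v -> guess s t w -> v = w.
  move=> [x [n [sx tn <-]]] [y [m []]]; rewrite sx => /below_inj <-.
  by rewrite tn => -[<-].
pose R s t := exists v,
  [/\ guess s t v, starts_with (F t) v & ~ starts_with (F s) v].
exists (fun p => `[< exists s t, [/\ ext_lt s t, p = [set s; t] & R s t] >]).
split.
- move=> [X [XS XW X0]].
  have ncX : ~ countable X.
    case: HW => _ unc _ cX; apply: unc; apply: sub_countable cX.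
    by case/card_eqPle: XW.
  have [v [s [Ss dens]]] := uncountable_splitting HW HT Finj XS ncX.
  have [_ [u Xu [su uv]]] := dens s Ss (@ext_le_refl _ _ s).
  have [n Sn hn] := hP u (XS _ Xu) v.
  have un := @snoc_ext_le _ _ u n.
  have [[t Xt [nt tv]] _] := dens _ Sn (ext_le_trans su un).
  have ut : ext_lt u t.
    by split; [apply: ext_le_trans nt | move=> eut; apply: uv; rewrite eut].
  have /X0[_ /negbT/asboolPn] : pairs X [set u; t] by exists u, t.
  apply; exists u, t; split=> //; exists v; split=> //.
  have [x ux] := suslin_seqs HT (XS _ Xu).
  by exists x, n; split=> //; apply: nt; apply: snocE.
- move=> [s [B [Ss Bs [f [[fB finj fsurj] fiso]] B1]]].
  have fR p q : lt_omega_plus2 p q -> ext_lt (f p) (f q) /\ R (f p) (f q).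
    move=> pq; have lt : ext_lt (f p) (f q) by apply/fiso.
    split=> //.
    (* The colour is read from an unordered pair, whose order gives back [f p] and [f q]. *)
    have /B1[_ /asboolP[s' [t' [lt' /(set2_ext_lt lt lt')[-> ->]]]]] :
      pairs B [set f p; f q] by exists (f p), (f q); split=> //; apply: fB.
    by [].
  have Sf p : S (f p) by have /Bs[] := fB p I.
  pose si i := f (inl i); pose t := f (inr ord0); pose u := f (inr ord_max).
  have sij i j : (i < j)%N -> ext_lt (si i) (si j) /\ R (si i) (si j).
    by move=> ij; apply: fR; apply: le_aa.
  have sit i : ext_lt (si i) t /\ R (si i) t by apply: fR; apply: le_ab.
  have siu i : ext_lt (si i) u /\ R (si i) u by apply: fR; apply: le_ab.
  have [[tu ntu] _] : ext_lt t u /\ R t u by apply: fR; apply: le_bb.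
  have /choice[v vP] i : exists v,
      [/\ guess (si i) t v, starts_with (F t) v & ~ starts_with (F (si i)) v].
    by have [] := sit i.
  (* As [u] extends [t], the word of [si i] below [u] is again [v i]. *)
  have vu i : starts_with (F u) (v i).
    have [_ [w [gw uw _]]] := siu i; have [gv _ _] := vP i.
    by rewrite (guess_inj _ _ _ _ (guess_mono _ _ _ _ tu gv) gw).
  have [||//|i [j [ij vij]]] := @starts_with_common (F t) (F u) v.
  + move=> Ftu; apply: ntu; apply: (ext_le_eq tu).
    exact: Finj (suslin_seqs HT (Sf _)) (suslin_seqs HT (Sf _)) Ftu.
  + by move=> i; have [] := vP i.
  (* The word of [si i] below [si j] is also [v i], so [v i] is an initial segment of [F (si j)],
     while [v j] is not. *)
  have [_ [w [gw jw _]]] := sij i j ij; have [gv _ _] := vP i.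
  have [_ _] := vP j; apply.
  have [[jt _] _] := sit j.
  by rewrite -vij (guess_inj _ _ _ _ gv (guess_mono _ _ _ _ jt gw)).
Qed.
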